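(* Let $p\in[1,+\infty)$ and let $\mathbf w=(w_n)_{n\in\mathbb Z_+}$ be a bounded sequence of positive real numbers. Let $B_{\mathbf w}$ be the unilateral weighted shift on $\ell^p(\mathbb Z_+)$ defined by $B_{\mathbf w}(e_n)=w_ne_{n-1}$ for $n\ge 1$ and $B_{\mathbf w}(e_0)=0$. The following assertions are equivalent. (i) $B_{\mathbf w}$ is frequently hypercyclic on $\ell^p(\mathbb Z_+)$; (ii) $B_{\mathbf w}$ is $\mathcal U$-frequently hypercyclic on $\ell^p(\mathbb Z_+)$; (iii) the series $\sum_{n\geq 1}\frac{1}{(w_1\cdots w_n)^p}$ is convergent.
   Context: $(e_n)_{n\in\mathbb Z_+}$ is the standard basis of $\ell^p(\mathbb Z_+)$, $\mathbb Z_+=\{0,1,2,\dots\}$. For $A\subset\mathbb Z_+$ let $A(n)=\{a\in A: a\le n\}$, $\underline d(A)=\liminf_{n\to+\infty}\frac{\#A(n)}{n}$ (lower density) and $\bar d(A)=\limsup_{n\to+\infty}\frac{\#A(n)}{n}$ (upper density). A bounded operator $T$ on a Banach space $X$ is frequently hypercyclic (resp. $\mathcal U$-frequently hypercyclic) if there is a vector $x\in X$ such that for every nonempty open $U\subset X$ the set $\{n\in\mathbb Z_+: T^nx\in U\}$ has positive lower density (resp. positive upper density). *)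

(* Defs.v *)
From HB Require Import structures.
From mathcomp Require Import all_boot all_order all_algebra.
From mathcomp Require Import all_classical all_reals all_analysis.
From mathcomp Require Import complex.

Set Implicit Arguments.
Unset Strict Implicit.
Unset Printing Implicit Defensive.

Import Order.TTheory GRing.Theory Num.Theory.
Import numFieldNormedType.Exports.

Local Open Scope classical_set_scope.
Local Open Scope ring_scope.

Section density.
Variable R : realType.
Implicit Types A : set nat.

Definition count_upto A (n : nat) : nat := #|[pred k : 'I_n.+1 | (k : nat) \in A]|.

(* The term of index 0 is a division by zero; it affects neither limit. *)
Definition lower_density A : \bar R :=
  limn_einf (fun n => ((count_upto A n)%:R / n%:R)%:E).

Definition upper_density A : \bar R :=
  limn_esup (fun n => ((count_upto A n)%:R / n%:R)%:E).

End density.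

Record bounded_operator (K : numFieldType) (X : normedModType K) :=
  BoundedOperator {
    operator :> {linear X -> X};
    (* equivalent to boundedness by linear_bounded_continuous *)
    operator_continuous : continuous operator }.

Section hypercyclicity.
Variables (R : realType) (K : numFieldType) (X : normedModType K).
Implicit Types T : bounded_operator X.

Definition frequently_hypercyclic T : Prop :=
  exists x : X, forall U : set X, open U -> U !=set0 ->
    (0 < lower_density R [set n | U (iter n T x)])%E.

Definition U_frequently_hypercyclic T : Prop :=
  exists x : X, forall U : set X, open U -> U !=set0 ->
    (0 < upper_density R [set n | U (iter n T x)])%E.

End hypercyclicity.

(* A common interface to the scalar fields R and R[i]: the norm of a
   numFieldType takes its values in the field itself, whereas p-th powers need
   an R-valued modulus. *)
Record scalars (R : realType) := Scalars {
  scalar_field :> numFieldType;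
  embed : {rmorphism R -> scalar_field};
  modulus : scalar_field -> R;
  embed_modulus : forall x, embed (modulus x) = `|x|;
  embed_norm : forall r, `|embed r| = embed `|r| }.

Definition real_scalars (R : realType) : scalars R :=
  @Scalars R R idfun Num.norm (fun=> erefl) (fun=> erefl).

Lemma embed_normc (R : realType) (x : R[i]) :
  real_complex R (ComplexField.Normc.normc x) = `|x|.
Proof. by []. Qed.

Lemma real_complex_norm (R : realType) (r : R) :
  `|real_complex R r| = real_complex R `|r|.
Proof. by rewrite normc_def /= expr0n addr0 sqrtr_sqr. Qed.

Definition complex_scalars (R : realType) : scalars R :=
  @Scalars R R[i] (real_complex R) (@ComplexField.Normc.normc R)
    (@embed_normc R) (@real_complex_norm R).

Section scalars_theory.
Variables (R : realType) (K : scalars R).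
Implicit Types (r s : R) (x y : K).

Lemma ler_embed r s : (embed K r <= embed K s) = (r <= s).
Proof.
have le_emb a b : a <= b -> embed K a <= embed K b.
  move=> ab; rewrite -subr_ge0 -rmorphB.
  by rewrite -[X in embed K X]ger0_norm ?subr_ge0// -embed_norm.
apply/idP/idP => [|/le_emb//]; case: (leP r s) => // sr rs.
have /(fmorph_inj (embed K)) : embed K r = embed K s.
  by apply/le_anti; rewrite rs le_emb// ltW.
by move=> rsE; rewrite rsE ltxx in sr.
Qed.

Lemma modulus_ge0 x : 0 <= modulus x.
Proof. by rewrite -ler_embed embed_modulus rmorph0. Qed.

Lemma modulusD x y : modulus (x + y) <= modulus x + modulus y.
Proof. by rewrite -ler_embed rmorphD/= !embed_modulus ler_normD. Qed.

Lemma modulusM x y : modulus (x * y) = modulus x * modulus y.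
Proof. by apply: (fmorph_inj (embed K)); rewrite rmorphM/= !embed_modulus normrM. Qed.

Lemma modulus_embed r : modulus (embed K r) = `|r|.
Proof. by apply: (fmorph_inj (embed K)); rewrite embed_modulus embed_norm. Qed.

Lemma modulus0 : modulus (0 : K) = 0.
Proof. by rewrite -(rmorph0 (embed K)) modulus_embed normr0. Qed.

Lemma modulus1 : modulus (1 : K) = 1.
Proof. by rewrite -(rmorph1 (embed K)) modulus_embed normr1. Qed.

Lemma modulus0_eq0 x : modulus x = 0 -> x = 0.
Proof.
by move=> x0; apply/eqP; rewrite -normr_eq0 -embed_modulus x0 rmorph0.
Qed.

End scalars_theory.

Section lp.
Variables (R : realType) (K : scalars R) (p : R) (p1 : 1 <= p).
Implicit Types (u v : nat -> K^o) (w : nat -> R).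

Definition lp_enorm u : \bar R :=
  'N[counting]_p%:E[EFin \o (fun n => modulus (u n))].

Lemma lp_enormE u :
  lp_enorm u = ((\sum_(k <oo) ((modulus (u k)) `^ p)%:E) `^ p^-1)%E.
Proof.
rewrite /lp_enorm Lnorm_counting ?(lt_le_trans ltr01)//; congr (_ `^ _)%E.
by apply: eq_eseriesr => k _; rewrite /= ger0_norm ?modulus_ge0.
Qed.

(* As for LfunType, the proof of 1 <= p is a parameter, so that it can be
   recovered when the normed structure on lp is inferred. *)
Definition lp_pred of 1 <= p : {pred nat -> K^o} := [pred u | `[< (lp_enorm u < +oo)%E >]].

Lemma lp_predP u : reflect (lp_enorm u < +oo)%E (u \in lp_pred p1).
Proof. exact: asboolP. Qed.

Lemma lp_enorm_ge0 u : (0 <= lp_enorm u)%E.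
Proof. exact: Lnorm_ge0. Qed.

Lemma le_lp_enorm u v (c : R) : 0 <= c ->
  (forall n, modulus (u n) <= c * modulus (v n)) ->
  (lp_enorm u <= c%:E * lp_enorm v)%E.
Proof.
move=> c0 uv; have p0 : 0 < p by exact: lt_le_trans p1.
have cE : c%:E = ((c `^ p)%:E `^ p^-1)%E.
  by rewrite poweR_EFin -powRrM mulfV ?gt_eqF// powRr1.
rewrite !lp_enormE cE -poweRM ?lee_fin ?powR_ge0//; last first.
  by apply: nneseries_ge0 => k _ _; rewrite lee_fin powR_ge0.
rewrite -nneseriesZl; last by move=> k _; rewrite lee_fin powR_ge0.
rewrite gt0_ler_poweR ?invr_ge0 ?(ltW p0)//.
- rewrite in_itv/= leey andbT.
  by apply: nneseries_ge0 => k _ _; rewrite lee_fin powR_ge0.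
- rewrite in_itv/= leey andbT.
  apply: nneseries_ge0 => k _ _.
  by rewrite mule_ge0// lee_fin powR_ge0.
- apply: lee_nneseries => [k _ _|k _]; first by rewrite lee_fin powR_ge0.
  rewrite -EFinM lee_fin -powRM ?modulus_ge0// ge0_ler_powR ?(ltW p0)//.
  + by rewrite nnegrE modulus_ge0.
  + by rewrite nnegrE mulr_ge0 ?modulus_ge0.
Qed.

Lemma lp_enormZ (a : K) u : lp_enorm (a *: u) = ((modulus a)%:E * lp_enorm u)%E.
Proof.
apply/eqP; rewrite eq_le; apply/andP; split.
  by apply: le_lp_enorm => [|n]; rewrite ?modulus_ge0// modulusM.
have [->|a0] := eqVneq a 0; first by rewrite modulus0 mul0e lp_enorm_ge0.
have ma0 : 0 < modulus a.
  rewrite lt_neqAle modulus_ge0 andbT eq_sym.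
  by apply: contra_neq a0; exact: modulus0_eq0.
rewrite -lee_pdivlMl//; apply: le_lp_enorm => [|n].
  by rewrite invr_ge0 ltW.
by rewrite modulusM mulKf ?gt_eqF.
Qed.

Lemma lp_enormD u v : (lp_enorm (u + v)%R <= lp_enorm u + lp_enorm v)%E.
Proof.
pose f k := modulus (u k); pose g k := modulus (v k).
have fg0 k : 0 <= f k + g k by rewrite addr_ge0// modulus_ge0.
have fgE : lp_enorm (fun k => embed K (f k + g k)) =
    ('N[counting]_p%:E[EFin \o (f \+ g)%R])%E.
  by apply: eq_Lnorm => k /=; rewrite modulus_embed ger0_norm.
apply: (@le_trans _ _ (lp_enorm (fun k => embed K (f k + g k)))); last first.
  by rewrite fgE; exact: eminkowski.
rewrite -[leRHS]mul1e; apply: le_lp_enorm => // k.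
by rewrite mul1r modulus_embed ger0_norm// modulusD.
Qed.

Lemma lp_enorm_coord u n : ((modulus (u n))%:E <= lp_enorm u)%E.
Proof.
have p0 : 0 < p by exact: lt_le_trans p1.
have -> : (modulus (u n))%:E = ((modulus (u n) `^ p)%:E `^ p^-1)%E.
  by rewrite poweR_EFin -powRrM mulfV ?gt_eqF// powRr1 ?modulus_ge0.
rewrite lp_enormE gt0_ler_poweR ?invr_ge0 ?(ltW p0)//.
- by rewrite in_itv/= leey andbT lee_fin powR_ge0.
- rewrite in_itv/= leey andbT.
  by apply: nneseries_ge0 => k _ _; rewrite lee_fin powR_ge0.
- rewrite (nneseries_split 0 n.+1); last by move=> k _; rewrite lee_fin powR_ge0.
  rewrite add0n big_mkord big_ord_recr/= -addeA addeCA leeDl// adde_ge0//.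
    by apply: sume_ge0 => i _; rewrite lee_fin powR_ge0.
  by apply: nneseries_ge0 => k _ _; rewrite lee_fin powR_ge0.
Qed.

Lemma lp_submod_closed : submod_closed (lp_pred p1).
Proof.
split.
  apply/lp_predP; rewrite -(scale0r (0 : nat -> K^o)) lp_enormZ modulus0 mul0e.
  exact: ltey.
move=> a u v /lp_predP uoo /lp_predP voo; apply/lp_predP.
rewrite (le_lt_trans (lp_enormD _ _))// lte_add_pinfty// lp_enormZ.
by rewrite lte_mul_pinfty ?lee_fin ?modulus_ge0.
Qed.

HB.instance Definition _ :=
  GRing.isSubmodClosed.Build K (nat -> K^o) (lp_pred p1) lp_submod_closed.

Record lp : Type := Lp { lp_seq :> nat -> K^o; lp_seqP : lp_seq \in lp_pred p1 }.

HB.instance Definition _ := [isSub for lp_seq].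
HB.instance Definition _ := [Choice of lp by <:].
HB.instance Definition _ := [SubChoice_isSubLmodule of lp by <:].

Definition lp_norm (u : lp) : K := embed K (fine (lp_enorm u)).

Lemma lp_enorm_fin (u : lp) : lp_enorm u \is a fin_num.
Proof. by rewrite ge0_fin_numE ?lp_enorm_ge0//; apply/lp_predP/lp_seqP. Qed.

Lemma lp_normD (u v : lp) : lp_norm (u + v) <= lp_norm u + lp_norm v.
Proof.
rewrite -rmorphD ler_embed -lee_fin EFinD !fineK ?lp_enorm_fin//.
exact: lp_enormD.
Qed.

Lemma lp_normZ (a : K) (u : lp) : lp_norm (a *: u) = `|a| * lp_norm u.
Proof.
rewrite -embed_modulus -rmorphM; congr (embed K _); apply: EFin_inj.
by rewrite EFinM !fineK ?lp_enorm_fin// -lp_enormZ.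
Qed.

Lemma lp_norm0_eq0 (u : lp) : lp_norm u = 0 -> u = 0.
Proof.
rewrite /lp_norm -(rmorph0 (embed K)) => /(fmorph_inj (embed K)) u0.
apply/val_inj/funext => n /=; apply: modulus0_eq0.
apply/le_anti; rewrite modulus_ge0 andbT -lee_fin.
by rewrite (le_trans (lp_enorm_coord u n))// -(fineK (lp_enorm_fin u)) u0.
Qed.

HB.instance Definition _ :=
  Lmodule_isNormed.Build K lp lp_normD lp_normZ lp_norm0_eq0.

Lemma lp_basis_subproof (n : nat) : (fun k => (k == n)%:R : K^o) \in lp_pred p1.
Proof.
have p0 : 0 < p by exact: lt_le_trans p1.
apply/lp_predP; rewrite lp_enormE poweR_lty//.
rewrite (nneseries_split 0 n.+1); last by move=> k _; rewrite lee_fin powR_ge0.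
rewrite [X in (_ + X)%E]eseries0 ?adde0; last first.
  move=> k; rewrite add0n => nk _.
  by rewrite gtn_eqF// modulus0 powR0// gt_eqF.
by rewrite sumEFin ltey.
Qed.

Definition lp_basis (n : nat) : lp := Lp (lp_basis_subproof n).

Section weighted_shift.
Variables (w : nat -> R) (wb : bounded_fun (w : nat -> R^o)).

(* B e_n = w_n e_(n-1), read on coordinates. *)
Definition shift_fun u : nat -> K^o := fun n => embed K (w n.+1) * u n.+1.

Lemma lp_enorm_shift : exists2 C : R, 0 <= C &
  forall u, (lp_enorm (shift_fun u) <= C%:E * lp_enorm u)%E.
Proof.
have [C C0 wC] : exists2 C : R, 0 < C & forall n, `|w n| <= C.
  have [C C0 wC] := pinfty_ex_gt0 wb.
  by exists C => // n; exact: wC.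
exists C => [|u]; first exact: ltW.
apply: (@le_trans _ _ (C%:E * lp_enorm (fun n => u n.+1))%E).
  apply: le_lp_enorm => [|n]; first exact: ltW.
  by rewrite modulusM modulus_embed ler_wpM2r ?modulus_ge0.
rewrite lee_pmul2l//; have p0 : 0 < p by exact: lt_le_trans p1.
have S0 F : (0 <= \sum_(k <oo) ((modulus (F k : K)) `^ p)%:E)%E.
  by apply: nneseries_ge0 => k _ _; rewrite lee_fin powR_ge0.
rewrite !lp_enormE gt0_ler_poweR ?invr_ge0 ?(ltW p0) ?in_itv/= ?leey ?S0//.
rewrite [leRHS](nneseries_split 0 1); last by move=> k _; rewrite lee_fin powR_ge0.
rewrite -[(0 + 1)%N]/1%N -(@nneseries_addn _ (fun k => ((modulus (u k)) `^ p)%:E) 1).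
  under eq_eseriesr => k _ do rewrite -[k.+1]addn1.
  by rewrite leeDr// sume_ge0// => i _; rewrite lee_fin powR_ge0.
by move=> k; rewrite lee_fin powR_ge0.
Qed.

Lemma shift_fun_lp (u : lp) : shift_fun u \in lp_pred p1.
Proof.
have [C C0 le_shift] := lp_enorm_shift; apply/lp_predP.
rewrite (le_lt_trans (le_shift u))// lte_mul_pinfty ?lee_fin//.
exact/lp_predP/lp_seqP.
Qed.

Definition lp_shift (u : lp) : lp := Lp (shift_fun_lp u).

Lemma lp_shift_linear : linear lp_shift.
Proof.
move=> a u v; apply/val_inj/funext => n /=.
by rewrite /shift_fun /= mulrDr mulrCA.
Qed.

HB.instance Definition _ :=
  GRing.isLinear.Build K lp lp *:%R lp_shift lp_shift_linear.

Lemma lp_shift_continuous : continuous lp_shift.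
Proof.
have [C C0 le_shift] := lp_enorm_shift.
apply: bounded_linear_continuous; apply/linear_boundedP.
have eC : 0 <= embed K C by rewrite -(rmorph0 (embed K)) ler_embed.
exists (embed K C); split=> [|r Cr u]; first exact: ger0_real.
rewrite (@le_trans _ _ (embed K C * `|u|)) ?ler_wpM2r ?(ltW Cr)//.
rewrite -[X in X <= _]/(lp_norm _) -[X in _ * X]/(lp_norm _) /lp_norm -rmorphM ler_embed.
by rewrite -lee_fin EFinM !fineK ?lp_enorm_fin// le_shift.
Qed.

Definition weighted_shift : bounded_operator lp :=
  BoundedOperator lp_shift_continuous.

Lemma weighted_shift_basis0 : weighted_shift (lp_basis 0) = 0.
Proof. by apply/val_inj/funext => n /=; rewrite /shift_fun /= mulr0. Qed.

Lemma weighted_shift_basisS n :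
  weighted_shift (lp_basis n.+1) = embed K (w n.+1) *: lp_basis n.
Proof.
apply/val_inj/funext => k; rewrite /= /shift_fun /= eqSS.
change (embed K (w k.+1) * (k == n)%:R = embed K (w n.+1) * (k == n)%:R).
by have [->|] := eqVneq k n; rewrite ?mulr0.
Qed.

End weighted_shift.

End lp.

(* Main.v *)
Require Import Defs.
From mathcomp Require Import all_boot all_order all_algebra.
From mathcomp Require Import all_classical all_reals all_analysis.
From mathcomp Require Import complex zify lra.
Import Order.TTheory GRing.Theory Num.Theory.
Import numFieldNormedType.Exports.
Local Open Scope classical_set_scope.
Local Open Scope ring_scope.

(* Put W_n = w_1 ... w_n and a_n = W_n^-p.

   If x is U-frequently hypercyclic, let A be the set of n such that B^n x is
   1/2-close to e_0. For n in A the coordinate x_n has modulus at least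
   1/(2 W_n), so reading the coordinates m - n of B^n x for m > n in A gives
   sum_(k >= 1, n + k in A) a_k <= 1. Averaging over n in A bounds the sum of a_k
   over those k for which A and A - k have a large intersection. Since A has
   positive upper density these k form a syndetic set, and a_k <= C a_(k+1), so
   that the whole series converges.

   Conversely, if the series converges, choose c_q tending to infinity with
   sum c_q a_q finite, a dense sequence y_v of finitely supported vectors which
   is slow with respect to c, and separated sets N_v of positive lower density.
   The vector x carrying y_v, pulled back by B^m, on the block starting at each m
   in N_v satisfies |(B^n x - y_v)_q|^p <= c_q a_q for q >= v and
   (B^n x)_q = y_v(q) for q < v, whenever n is in N_v. *)

(** * Counting functions and densities *)

Lemma count_uptoE (A : set nat) n :
  count_upto A n = (\sum_(0 <= k < n.+1) (k \in A))%N.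
Proof. by rewrite /count_upto -sum1_card big_mkcond big_mkord. Qed.

Lemma count_upto_leD (A : set nat) n t :
  (count_upto A (n + t) <= count_upto A n + t)%N.
Proof.
rewrite !count_uptoE.
rewrite (@big_cat_nat _ _ _ n.+1)//= ?leq_add2l; last by rewrite ltnS leq_addr.
rewrite (leq_trans (@leq_sum _ _ _ _ (fun=> 1%N) _))//.
  by move=> i; case: (_ \in _).
by rewrite sum_nat_const_nat muln1 -addSn addKn.
Qed.

Lemma count_upto_shift (A : set nat) n t :
  (count_upto A (n + t) <= count_upto [set k | A (k + t)%N] n + t)%N.
Proof.
rewrite !count_uptoE.
rewrite (@big_cat_nat _ _ _ t)//=; last by rewrite -addSn leq_addl.
rewrite addnC leq_add//.
  by rewrite -{1}(add0n t) big_addn -addSn addnK leqnn.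
rewrite (leq_trans (@leq_sum _ _ _ _ (fun=> 1%N) _))//.
  by move=> i; case: (_ \in _).
by rewrite sum_nat_const_nat muln1 subn0.
Qed.

Lemma count_upto_shift_le (A : set nat) n t :
  (count_upto [set k | A (k + t)%N] n <= count_upto A n + t)%N.
Proof.
apply: leq_trans (count_upto_leD A n t).
rewrite !count_uptoE.
rewrite [leqRHS](@big_cat_nat _ _ _ t)//=; last by rewrite -addSn leq_addl.
apply: leq_trans (leq_addl _ _).
by rewrite -{2}(add0n t) big_addn -addSn addnK leqnn.
Qed.

Lemma upper_density_gt0P (R : realType) (A : set nat) :
  (0 < upper_density R A)%E ->
  exists2 d : R, 0 < d &
    forall M, exists2 N, (M <= N)%N & d * N%:R <= (count_upto A N)%:R.
Proof.
rewrite /upper_density limn_esup_lim.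
rewrite (cvg_lim _ (@cvg_esups_inf R _))// => d0.
have [d /andP[d0' dlt]] : exists d : R, (0 < d) && (d%:E < ereal_inf (range (esups
   (fun n => ((count_upto A n)%:R / n%:R)%:E : \bar R))))%E.
  move: d0; case: ereal_inf => [r||]//; rewrite ?lte_fin => r0.
    by exists (r / 2); rewrite lte_fin; apply/andP; split; lra.
  by exists 1; rewrite ltr01 ltry.
exists d => // M.
have : (d%:E < esups (fun n => ((count_upto A n)%:R / n%:R)%:E : \bar R) M.+1)%E.
  (* The tail starts at [M.+1], so the [N] extracted from it is positive and the division can be
     cleared. *)
  by apply: lt_le_trans dlt _; apply: ereal_inf_lbound; exists M.+1.
move=> /ereal_sup_gt[_ [N /= MN <-]]; rewrite lte_fin => dN.
exists N; first exact: ltnW.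
have N0 : (0 : R) < N%:R by rewrite ltr0n (leq_trans _ MN).
by rewrite -ler_pdivlMr// ltW.
Qed.

Lemma lower_density_gt0 (R : realType) (A : set nat) (c : R) n0 : 0 < c ->
  (forall n, (n0 <= n)%N -> c * n%:R <= (count_upto A n)%:R) ->
  (0 < lower_density R A)%E.
Proof.
move=> c0 cA; rewrite /lower_density limn_einf_lim.
rewrite (cvg_lim _ (@cvg_einfs_sup R _))//.
apply: (@lt_le_trans _ _ c%:E); first by rewrite lte_fin.
apply: (@le_trans _ _
  (einfs (fun n => ((count_upto A n)%:R / n%:R)%:E : \bar R) n0.+1)); last first.
  by apply: ereal_sup_ubound; exists n0.+1.
apply: le_ereal_inf_tmp => _ [n /= n0n <-].
by rewrite lee_fin ler_pdivlMr ?ltr0n ?(leq_trans _ n0n)// cA// ltnW.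
Qed.

(** * Overlaps between translates of a set of positive upper density *)

(** If [s] of the bits are true, the double sum is [s (s - 1) / 2], which is at least [s - 1]. *)
Lemma sum_le_one_add_pairs (b : nat -> bool) r :
  (\sum_(j < r) b j <= 1 + \sum_(j < r) \sum_(i < j) (b i && b j))%N.
Proof.
elim: r => [|r IH]; first by rewrite !big_ord0.
rewrite !big_ord_recr /=; case br : (b r); last first.
  by rewrite addn0 (leq_trans IH)// leq_add2l leq_addr.
have -> : (\sum_(i < r) (b i && true) = \sum_(i < r) b i)%N.
  by apply: eq_bigr => i _; rewrite andbT.
case: (posnP (\sum_(i < r) b i)%N) => [->|s0]; first by rewrite add0n leq_addr.
by rewrite addnA leq_add.
Qed.

(** The bound by pairs is applied at each point [k <= N] to membership in the [r] translates, then
    summed over [k]; the sum of the [t j] pays for the points lost by translating. *)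
Lemma sum_count_shift (A : set nat) (t : nat -> nat) r N :
  (\sum_(j < r) count_upto A N <=
   N.+1 + \sum_(j < r) t j + \sum_(j < r) \sum_(i < j)
     count_upto [set n | A (n + t i)%N /\ A (n + t j)%N] N)%N.
Proof.
have le1 : (\sum_(j < r) count_upto A N <=
    \sum_(j < r) count_upto [set n | A (n + t j)%N] N + \sum_(j < r) t j)%N.
  rewrite -big_split /=; apply: leq_sum => j _.
  apply: leq_trans (count_upto_shift A N (t j)).
  rewrite !count_uptoE.
  by rewrite [leqRHS](@big_cat_nat _ _ _ N.+1) ?leq_addr//= ltnS leq_addr.
apply: leq_trans le1 _; rewrite addnAC leq_add2r.
under eq_bigr do rewrite count_uptoE big_mkord.
under [X in (_ + X)%N]eq_bigr => j _.
  under eq_bigr do rewrite count_uptoE big_mkord.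
  rewrite exchange_big; over.
rewrite exchange_big [X in (_ + X)%N]exchange_big /=.
have NE : (N.+1 = \sum_(k < N.+1) 1)%N by rewrite sum1_card card_ord.
rewrite [X in (_ <= X + _)%N]NE -big_split /=; apply: leq_sum => k _.
have := sum_le_one_add_pairs (fun j => (k : nat) \in [set n | A (n + t j)%N]) r.
move=> /leq_trans; apply; rewrite leq_add2l.
apply: leq_sum => j _; apply: leq_sum => i _.
by rewrite /= /in_mem /= /in_set -asbool_and.
Qed.

(* The ultrafilter decides, for all [k] at once, whether [A] and [A - k] have a
   large intersection. If the set [D] of the good [k] were not syndetic, one
   could build [t 0 <= t 1 <= ...] with no difference in [D]: then [r] translates
   of [A] would be almost disjoint, which is absurd for [r * d >= 3]. *)
Lemma syndetic_correlations (R : realType) (A : set nat) (d : R) : 0 < d ->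
  (forall M, exists2 N, (M <= N)%N & d * N%:R <= (count_upto A N)%:R) ->
  exists2 e : R, 0 < e & exists D : set nat, exists L : nat,
    (forall t, exists2 j, (j <= L)%N & D (t + j)%N) /\
    (forall K M, exists2 N, (M <= N)%N & forall k, (k < K)%N -> D k ->
      e * N%:R <= (count_upto [set n | A n /\ A (n + k)%N] N)%:R).
Proof.
move=> d0 dA.
(* Every set of an ultrafilter finer than [F] contains arbitrarily large times at which the density
   of [A] is at least [d]. *)
pose F := filter_from [set: nat]
  (fun M => [set N | (M <= N)%N /\ d * N%:R <= (count_upto A N)%:R]).
have FF : ProperFilter F.
  apply: filter_from_proper.
    apply: filter_from_filter; first by exists 0%N.
    move=> i j _ _; exists (maxn i j) => // N /= [].
    by rewrite geq_max => /andP[].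
  by move=> M _; have [N MN dN] := dA M; exists N.
have [G [GU FG]] := ultraFilterLemma FF.
have GM M : G [set N | (M <= N)%N /\ d * N%:R <= (count_upto A N)%:R].
  by apply: FG; exists M.
have [r r3] : exists r : nat, 3 <= r%:R * d.
  exists (Num.truncn (3 / d)).+1; rewrite -ler_pdivrMr// ltW//.
  exact: truncnS_gt.
have r0 : (0 : R) < r%:R.
  by rewrite -(pmulr_lgt0 _ d0) (lt_le_trans _ r3).
(* There are at most [r ^ 2] pairs of translates, so overlaps below [e * N] add up to at most
   [N]. *)
pose e : R := (r%:R ^+ 2)^-1.
have e0 : 0 < e by rewrite invr_gt0 exprn_gt0.
pose C k := [set N | e * N%:R <= (count_upto [set n | A n /\ A (n + k)%N] N)%:R].
pose D := [set k | G (C k)].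
have Gall K (P : nat -> set nat) : (forall k, (k < K)%N -> G (P k)) ->
    G [set N | forall k, (k < K)%N -> P k N].
  elim: K => [|K IH] GP; first by apply: filterS (filterT) => N _ k.
  apply: filterS (filterI (GP K (ltnSn K)) (IH _)) => [N [PK PN] k|k kK].
    by rewrite ltnS leq_eqVlt => /predU1P[->|/PN].
  by apply: GP; exact: ltnW.
exists e => //; exists D.
suff [L DL] : exists L, forall t, exists2 j, (j <= L)%N & D (t + j)%N.
  exists L; split=> // K M.
  have GK : G [set N | forall k, (k < K)%N -> D k -> C k N].
    apply: Gall => k _; have [Dk|nDk] := pselect (D k).
      by apply: filterS Dk => N.
    by apply: filterS (filterT) => N.
  have [N [NK [MN _]]] := filter_ex (filterI GK (GM M)).
  by exists N => // k kK Dk; exact: NK.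
apply: contrapT => /forallNP nL.
have /choice[g gD] L : exists t, forall j, (j <= L)%N -> ~ D (t + j)%N.
  apply: contrapT => /forallNP ng; apply: (nL L) => t.
  apply: contrapT => nt; apply: (ng t) => j jL Dj; apply: nt.
  by exists j.
(* [g L] starts a window of [L + 1] points outside [D]. As [t j.+1 - t i = g (t j) + (t j - t i)]
   with [t j - t i <= t j], every difference falls in such a window. *)
pose t := fix t n := if n is m.+1 then (g (t m) + t m)%N else 0%N.
have t_le i j : (i <= j)%N -> (t i <= t j)%N.
  elim: j => [|j IH]; first by rewrite leqn0 => /eqP->.
  rewrite leq_eqVlt => /predU1P[->//|]; rewrite ltnS => /IH /leq_trans -> //=.
  exact: leq_addl.
have tD i j : (i < j)%N -> ~ D (t j - t i)%N.
  case: j => // j; rewrite ltnS => /t_le tij /=.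
  by rewrite -addnBA//; apply: gD; exact: leq_subr.
have GD : G [set N | forall j, (j < r)%N -> forall i, (i < j)%N ->
    ~ C (t j - t i)%N N].
  apply: (Gall) => j _; apply: (@Gall j (fun i => ~` C (t j - t i)%N)) => i ij.
  by have [/(tD _ _ ij)|] := in_ultra_setVsetC (C (t j - t i)%N) GU.
(* [S] collects the boundary terms; with [N >= S + 2] the count becomes
   [3 N <= 2 N + 1 + S < 3 N]. *)
pose S := (\sum_(j < r) t j + \sum_(j < r) \sum_(i < j) t i)%N.
have [N [ND [SN dN]]] := filter_ex (filterI GD (GM (S + 2)%N)).
have := sum_count_shift A t r N.
rewrite sum_nat_const card_ord -(ler_nat R) natrM => rN.
have pairN : (\sum_(j < r) \sum_(i < j)
     count_upto [set n | A (n + t i)%N /\ A (n + t j)%N] N)%:R <=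
     N%:R + (\sum_(j < r) \sum_(i < j) t i)%:R :> R.
  have -> : N%:R = \sum_(j < r) (r%:R * (e * N%:R)).
    rewrite sumr_const card_ord -[RHS]mulr_natl !mulrA -expr2 mulfV ?mul1r//.
    by rewrite expf_neq0// gt_eqF.
  rewrite !natr_sum -big_split; apply: ler_sum => j _ /=.
  apply: (@le_trans _ _ (\sum_(i < j) (e * N%:R + (t i)%:R))).
    rewrite natr_sum; apply: ler_sum => i _.
    have := ND j (ltn_ord j) i (ltn_ord i).
    move=> /negP; rewrite -ltNge => /ltW cN; apply: le_trans (lerD cN (lexx _)).
    rewrite -natrD ler_nat.
    apply: leq_trans
      (count_upto_shift_le [set n | A n /\ A (n + (t j - t i))%N] _ (t i)).
    rewrite !count_uptoE; apply: leq_sum => k _; rewrite /= /in_mem /= /in_set.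
    case: asboolP => //= -[Ai Aj]; rewrite asboolT//=; split=> //.
    by rewrite -addnA subnKC// t_le// ltnW.
  rewrite big_split /= natr_sum lerD2r sumr_const card_ord -[leLHS]mulr_natl.
  by rewrite ler_wpM2r ?ler_nat ?(ltnW (ltn_ord j))// mulr_ge0// ltW.
move: rN SN pairN; rewrite /S !natrD -(ler_nat R) !natrD => rN SN pairN.
have : r%:R * (d * N%:R) <= r%:R * (count_upto A N)%:R.
  by rewrite ler_wpM2l// ltW.
have : 3 * N%:R <= r%:R * d * N%:R by rewrite ler_wpM2r.
rewrite -mulrA -[N.+1%:R]natr1 in rN * => h1 h2.
move: (\sum_(j < r) t j)%N (\sum_(j < r) \sum_(i < j) t i)%N rN SN pairN => S1 S2.
lra.
Qed.

(** Double counting of the pairs [n], [n + k] in [A]: for fixed [n <= N] the [a k] sum to at most 1,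
    while each [k] in [D] occurs for at least [e * N] values of [n]. So the sum over [D] is at most
    [(N + 1) / (e N) <= 2 / e]. *)
Lemma bounded_sum_of_upper_density (R : realType) (A : set nat)
    (a : nat -> R) (c : R) :
  (0 < upper_density R A)%E ->
  (forall k, 0 <= a k) -> 1 <= c -> (forall k, a k <= c * a k.+1) ->
  (forall n K, A n -> \sum_(1 <= k < K | (n + k)%N \in A) a k <= 1) ->
  exists M, forall K, \sum_(1 <= k < K) a k <= M.
Proof.
move=> /upper_density_gt0P[d d0 dA] a0 c1 ac aA.
have [e e0 [D [L [DL eD]]]] := syndetic_correlations _ _ _ d0 dA.
have sumD K : \sum_(1 <= k < K | k \in D) a k <= 2 / e.
  have [N N0 eN] := eD K 1%N.
  have N0' : (0 : R) < N%:R by rewrite ltr0n.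
  rewrite ler_pdivlMr// -(ler_pM2r N0').
  apply: (@le_trans _ _ (\sum_(1 <= k < K)
      (count_upto [set n | A n /\ A (n + k)%N] N)%:R * a k)).
    rewrite mulr_suml mulr_suml big_mkcond/= !big_nat.
    apply: ler_sum => k /andP[k1 kK].
    case: ifPn => [|_]; last by rewrite mulr_ge0.
    by rewrite inE => Dk; rewrite -mulrA mulrC ler_wpM2r// eN.
  apply: (@le_trans _ _ (\sum_(0 <= n < N.+1) 1)); last first.
    rewrite sumr_const_nat subn0 -[leLHS]natr1.
    by move: N0; rewrite -(ler_nat R); lra.
  under eq_bigr do rewrite count_uptoE natr_sum mulr_suml.
  rewrite exchange_big_nat; apply: ler_sum => n _ /=.
  have [An|nAn] := pselect (A n); last first.
    rewrite big1 ?ler01// => k _.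
    by rewrite memNset ?mul0r// => -[].
  apply: le_trans (aA n K An); rewrite [leRHS]big_mkcond/=.
  apply: ler_sum => k _; case: ifPn => nk.
    by rewrite ler_piMl// (_ : 1 = 1%:R)// ler_nat leq_b1.
  by rewrite memNset ?mul0r// => -[_ Ank]; rewrite mem_set in nk.
have c0 : 0 <= c by exact: le_trans ler01 c1.
have acj j t : a t <= c ^+ j * a (t + j)%N.
  elim: j => [|j IH]; first by rewrite addn0 mul1r.
  by rewrite (le_trans IH)// exprSr -mulrA ler_wpM2l ?exprn_ge0// addnS.
have acL j t : (j <= L)%N -> a t <= c ^+ L * a (t + j)%N.
  move=> jL; rewrite (le_trans (acj j t))// ler_wpM2r//.
  by rewrite ler_weXn2l.
(* Each [t] is charged to some [t + j] in [D] with [j <= L], at the price [c ^+ L]; for fixed [j]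
   these points are distinct, so [2 / e] bounds their sum. *)
exists (\sum_(0 <= j < L.+1) c ^+ L * (2 / e)) => K.
apply: (@le_trans _ _ (\sum_(0 <= j < L.+1) c ^+ L *
    \sum_(1 <= t < K | (t + j)%N \in D) a (t + j)%N)).
  under [leRHS]eq_bigr do rewrite mulr_sumr big_mkcond/=.
  rewrite exchange_big_nat; apply: ler_sum => t _ /=.
  have [j jL Dj] := DL t.
  rewrite (bigD1_seq j) ?mem_index_iota ?iota_uniq//=.
  rewrite mem_set// (le_trans (acL j t jL))// lerDl.
  by apply: sumr_ge0 => i _; case: ifP => // _; rewrite mulr_ge0// exprn_ge0.
apply: ler_sum => j _; rewrite ler_wpM2l ?exprn_ge0//.
apply: le_trans (sumD (K + j)%N).
rewrite -{1}[K](addnK j) -(big_addn 1 (K + j) j (mem D) a).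
have [jK|jK] := leqP (1 + j)%N (K + j)%N; last first.
  by rewrite big_geq ?(ltnW jK)// sumr_ge0.
rewrite [leRHS](@big_cat_nat _ _ _ (1 + j)%N)//= ?ler_wpDl//.
  exact: sumr_ge0.
Qed.

(** * Norms in [lp] through finite sums of p-th powers *)

Lemma ler_powR2 (R : realType) (p a b : R) : 0 < p -> 0 <= a -> 0 <= b ->
  (a `^ p <= b `^ p) = (a <= b).
Proof.
move=> p0 a0 b0; apply/idP/idP => [|ab]; last first.
  by apply: ge0_ler_powR; rewrite ?nnegrE// ltW.
apply: contraTT; rewrite -!ltNge => ba.
by apply: gt0_ltr_powR; rewrite ?nnegrE.
Qed.

Lemma modulusN (R : realType) (K : scalars R) (x : K) : modulus (- x) = modulus x.
Proof. by apply: (fmorph_inj (embed K)); rewrite !embed_modulus normrN. Qed.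

Section lp_partial_sums.
Variables (R : realType) (K : scalars R) (p : R) (p1 : 1 <= p).
Implicit Types (u : nat -> K^o) (v : lp K p1).

Lemma lp_enorm_le_partial_sums u (M : R) : 0 <= M ->
  (forall N, \sum_(0 <= k < N) modulus (u k) `^ p <= M) ->
  (lp_enorm p u <= (M `^ p^-1)%:E)%E.
Proof.
move=> M0 uM; have p0 : 0 < p by exact: lt_le_trans p1.
rewrite lp_enormE// -poweR_EFin.
rewrite gt0_ler_poweR ?invr_ge0 ?(ltW p0) ?in_itv/= ?leey ?andbT//.
  by apply: nneseries_ge0 => k _ _; rewrite lee_fin powR_ge0.
apply: lime_le; first by apply: is_cvg_nneseries => k _ _; rewrite lee_fin powR_ge0.
by apply: nearW => N; rewrite sumEFin lee_fin.
Qed.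

Lemma partial_sums_le_lp_enorm u (e : R) : 0 <= e -> (lp_enorm p u <= e%:E)%E ->
  forall N, \sum_(0 <= k < N) modulus (u k) `^ p <= e `^ p.
Proof.
move=> e0 ue N; have p0 : 0 < p by exact: lt_le_trans p1.
have S0 : 0 <= \sum_(0 <= k < N) modulus (u k) `^ p.
  by apply: sumr_ge0 => k _; exact: powR_ge0.
have : (((\sum_(0 <= k < N) modulus (u k) `^ p) `^ p^-1)%:E <= e%:E)%E.
  apply: le_trans ue; rewrite lp_enormE// -poweR_EFin.
  rewrite gt0_ler_poweR ?invr_ge0 ?(ltW p0) ?in_itv/= ?leey ?andbT ?lee_fin//.
    by apply: nneseries_ge0 => k _ _; rewrite lee_fin powR_ge0.
  rewrite -sumEFin; apply: nneseries_lim_ge => k _ _.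
  by rewrite lee_fin powR_ge0.
rewrite lee_fin => /(ge0_ler_powR (ltW p0)).
rewrite !nnegrE powR_ge0 e0 => /(_ isT isT).
by rewrite -powRrM mulVf ?gt_eqF// powRr1.
Qed.

Lemma lp_norm_le v (M : R) : 0 <= M ->
  (forall N, \sum_(0 <= k < N) modulus (v k) `^ p <= M) ->
  `|v| <= embed K (M `^ p^-1).
Proof.
move=> M0 vM; rewrite -[`|v|]/(lp_norm v) /lp_norm ler_embed.
by rewrite -lee_fin fineK ?lp_enorm_fin// lp_enorm_le_partial_sums.
Qed.

Lemma partial_sums_le v (e : R) : `|v| <= embed K e ->
  forall N, \sum_(0 <= k < N) modulus (v k) `^ p <= e `^ p.
Proof.
rewrite -[`|v|]/(lp_norm v) /lp_norm ler_embed => ve.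
have e0 : 0 <= e by rewrite (le_trans _ ve)// fine_ge0 ?lp_enorm_ge0.
apply: partial_sums_le_lp_enorm => //.
by rewrite -(fineK (lp_enorm_fin v)) lee_fin.
Qed.

Lemma lp_predP_partial_sums u (M : R) :
  (forall N, \sum_(0 <= k < N) modulus (u k) `^ p <= M) -> u \in lp_pred p1.
Proof.
move=> uM; apply/lp_predP.
rewrite (le_lt_trans (lp_enorm_le_partial_sums _ _ _ uM)) ?ltry//.
by rewrite (le_trans _ (uM 0%N))// big_nil.
Qed.

Lemma lp_partial_sums_bounded v :
  exists M, forall N, \sum_(0 <= k < N) modulus (v k) `^ p <= M.
Proof.
exists (fine (lp_enorm p v) `^ p); apply: partial_sums_le.
by rewrite -[`|v|]/(lp_norm v).
Qed.

End lp_partial_sums.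

Lemma tail_small (R : realType) (a : nat -> R) (M e : R) : (forall k, 0 <= a k) ->
  (forall N, \sum_(0 <= k < N) a k <= M) -> 0 < e ->
  exists Q, forall N, \sum_(Q <= k < N) a k <= e.
Proof.
move=> a0 aM e0.
have hs : has_sup (range (fun N => \sum_(0 <= k < N) a k)).
  by split; [exists (\sum_(0 <= k < 0) a k), 0%N | exists M => _ [N _ <-]].
have [_ [Q _ <-] supQ] := sup_adherent e0 hs.
exists Q => N; have [QN|NQ] := leqP Q N; last by rewrite big_geq ?ltW// ltnW.
have : \sum_(0 <= k < N) a k <= sup (range (fun N => \sum_(0 <= k < N) a k)).
  by apply: sup_upper_bound => //; exists N.
rewrite (@big_cat_nat _ _ _ Q)//=; lra.
Qed.

(** * Products of weights, and necessity of the convergence *)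

Section weights.
Variables (R : realType) (K : scalars R) (p : R) (p1 : 1 <= p).
Variables (w : nat -> R) (w0 : forall n, 0 < w n).
Variable wb : bounded_fun (w : nat -> R^o).

Definition weight n := \prod_(1 <= k < n.+1) w k.

Lemma weight_gt0 n : 0 < weight n.
Proof. exact: prodr_gt0. Qed.

Lemma weight0 : weight 0 = 1.
Proof. by rewrite /weight big_geq. Qed.

Lemma weightS n : weight n.+1 = weight n * w n.+1.
Proof. by rewrite /weight big_nat_recr. Qed.

(** The factor [w_(q+1) ... w_(q+n)] picked up along the orbit telescopes into a quotient of two
    weights. *)
Lemma iter_weighted_shift n (x : lp K p1) q :
  iter n (weighted_shift K p1 wb) x q =
  embed K (weight (n + q) / weight q) * x (n + q)%N.
Proof.
elim: n q => [|n IH] q; first by rewrite divff ?gt_eqF ?weight_gt0// rmorph1 mul1r.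
rewrite iterS /= /shift_fun IH mulrA -rmorphM addSnnS; congr (embed K _ * _).
rewrite (weightS q) mulrCA; congr (_ * _).
by rewrite invfM mulrCA mulfV ?mulr1// gt_eqF.
Qed.

(** The ratio of consecutive terms is [w k.+1 ^ p], bounded because [w] is; the maximum with 1 makes
    the powers of [c] nondecreasing. *)
Lemma weight_powR_le : exists2 c : R, 1 <= c &
  forall k, (weight k `^ p)^-1 <= c * (weight k.+1 `^ p)^-1.
Proof.
have p0 : 0 < p by exact: lt_le_trans p1.
have [C C0 wC] : exists2 C : R, 0 < C & forall n, `|w n| <= C.
  by have [C C0 wC] := pinfty_ex_gt0 wb; exists C => // n; exact: wC.
exists (Num.max 1 C `^ p).
  rewrite -[X in X <= _](congr1 (@^~ p) (powR1 R)) /=.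
  by rewrite ge0_ler_powR ?nnegrE ?(ltW p0)// ?le_max ?lexx ?ler01.
move=> k; rewrite weightS powRM ?(ltW (weight_gt0 _)) ?(ltW (w0 _))//.
rewrite invfM mulrCA ler_peMr ?invr_ge0 ?powR_ge0//.
rewrite ler_pdivlMr ?powR_gt0// mul1r ge0_ler_powR ?nnegrE ?(ltW p0) ?(ltW (w0 _))//.
  by rewrite le_max ler01.
by rewrite le_max (le_trans _ (wC k.+1)) ?orbT// ler_norm.
Qed.

Lemma bounded_sum_of_U_frequently_hypercyclic :
  U_frequently_hypercyclic R (weighted_shift K p1 wb) ->
  exists M, forall N, \sum_(1 <= n < N) (weight n `^ p)^-1 <= M.
Proof.
have p0 : 0 < p by exact: lt_le_trans p1.
move=> [x xU].
have h0 : 0 < embed K 2^-1 by rewrite fmorphV rmorph_nat invr_gt0.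
have /= := nbhsx_ballx (lp_basis K p1 0) (PosNum h0)%:num (gt0 _).
rewrite nbhsE => -[U [oU Ue0] Uball].
have Un0 : U !=set0 by exists (lp_basis K p1 0).
set A := [set n | U (iter n (weighted_shift K p1 wb) x)].
have AxE n : A n -> forall N,
   \sum_(0 <= k < N)
     modulus ((iter n (weighted_shift K p1 wb) x - lp_basis K p1 0) k) `^ p
   <= 2^-1 `^ p.
  move=> /Uball An; apply: partial_sums_le; rewrite distrC; apply: ltW.
  by move: An; rewrite -ball_normE.
have Ax n : A n -> 2^-1 <= weight n * modulus (x n).
  (* The partial sum of length 1 isolates coordinate 0, where [B^n x] is [W_n x_n] and [e_0] is
     1. *)
  move=> /AxE /(_ 1%N); rewrite big_nat1 ler_powR2 ?modulus_ge0 ?invr_ge0//.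
  change (modulus (iter n (weighted_shift K p1 wb) x 0%N - 1 : K) <= 2^-1 ->
    2^-1 <= weight n * modulus (x n)).
  rewrite iter_weighted_shift addn0 weight0 divr1 => xn.
  have := modulusD (embed K (weight n) * x n) (- (embed K (weight n) * x n - 1)).
  rewrite opprB addrC subrK modulus1 -opprB modulusN modulusM modulus_embed.
  rewrite (ger0_norm (ltW (weight_gt0 n))).
  by move=> /le_trans/(_ (lerD (lexx _) xn)); lra.
have [c c1 wc] := weight_powR_le.
apply: (bounded_sum_of_upper_density _ A _ c) => //.
- exact: xU.
- by move=> k; rewrite invr_ge0 powR_ge0.
move=> n N An.
have h2 : (0 : R) < 2^-1 `^ p by rewrite powR_gt0// invr_gt0.
rewrite -(ler_pM2l h2) mulr1.
apply: le_trans (AxE n An N); case: N => [|N]; first by rewrite !big_geq ?mulr0.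
(* Coordinate 0 is discarded. At [k >= 1] the vector [e_0] vanishes and [B^n x] has modulus
   [W_(n+k) |x_(n+k)| / W_k], at least [1 / (2 W_k)] if [n + k] is in [A]. *)
rewrite [leRHS]big_ltn// ler_wpDl ?powR_ge0// mulr_sumr big_mkcond/= !big_nat.
apply: ler_sum => -[//|k] _; case: ifPn => [|_]; last exact: powR_ge0.
rewrite inE => /Ax Ank; have wk0 := weight_gt0 k.+1.
rewrite ler_pdivrMr ?powR_gt0// -powRM ?modulus_ge0 ?(ltW wk0)//.
rewrite ler_powR2 ?invr_ge0 ?mulr_ge0 ?modulus_ge0 ?(ltW wk0)//.
change (2^-1 <=
  modulus (iter n (weighted_shift K p1 wb) x k.+1 - 0 : K) * weight k.+1).
rewrite subr0 iter_weighted_shift modulusM modulus_embed ger0_norm; last first.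
  by rewrite divr_ge0// ltW// weight_gt0.
by rewrite mulrAC divfK ?gt_eqF.
Qed.

End weights.

(** * Slow weights and separated sets of positive lower density *)

(* With [r q] the tail of the series, [c q = 1 / sqrt (r q)] works since
   [a q / sqrt (r q) <= 2 (sqrt (r q) - sqrt (r q.+1))] telescopes. *)
Lemma summable_slow_weights (R : realType) (a : nat -> R) (M : R) :
  (forall q, 0 < a q) -> (forall N, \sum_(0 <= q < N) a q <= M) ->
  exists c : nat -> R, [/\ forall q, 0 <= c q,
    forall C, exists Q, forall q, (Q <= q)%N -> C <= c q &
    exists M', forall N, \sum_(0 <= q < N) c q * a q <= M'].
Proof.
move=> a0 aM; pose S N := \sum_(0 <= q < N) a q.
have SS q : S q.+1 = S q + a q by rewrite /S big_nat_recr.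
have hs : has_sup (range S).
  by split; [exists (S 0%N), 0%N | exists M => _ [N _ <-]; exact: aM].
pose r q := sup (range S) - S q.
have rS q : r q.+1 = r q - a q by rewrite /r SS opprD addrA.
have r_ge0 q : 0 <= r q.
  by rewrite subr_ge0; apply: sup_upper_bound => //; exists q.
have r_gt0 q : 0 < r q by have := r_ge0 q.+1; have := a0 q; rewrite rS; lra.
have sr_gt0 q : 0 < Num.sqrt (r q) by rewrite sqrtr_gt0.
have r_le Q q : (Q <= q)%N -> r q <= r Q.
  move=> Qq; rewrite lerD2l lerN2 /S [leRHS](@big_cat_nat _ _ _ Q)//=.
  by rewrite lerDl sumr_ge0// => i _; exact: ltW.
exists (fun q => (Num.sqrt (r q))^-1); split.
- by move=> q; rewrite invr_ge0 ltW.
- move=> C; pose C1 := Num.max 1 C.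
  have C1_gt0 : 0 < C1 by rewrite lt_max ltr01.
  have e0 : 0 < (C1 ^+ 2)^-1 by rewrite invr_gt0 exprn_gt0.
  have [_ [Q _ <-] supQ] := sup_adherent e0 hs.
  exists Q => q Qq; apply: (@le_trans _ _ C1); first by rewrite le_max lexx orbT.
  rewrite -[C1]invrK lef_pV2 ?posrE ?invr_gt0//.
  rewrite -[leRHS]ger0_norm ?invr_ge0 ?(ltW C1_gt0)// -sqrtr_sqr ler_wsqrtr//.
  by rewrite exprVn (le_trans (r_le _ _ Qq))// /r; lra.
- exists (2 * Num.sqrt (r 0%N)) => N.
  suff : \sum_(0 <= q < N) (Num.sqrt (r q))^-1 * a q <=
      2 * (Num.sqrt (r 0%N) - Num.sqrt (r N)) by have := sr_gt0 N; lra.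
  elim: N => [|N IH]; first by rewrite big_geq// subrr mulr0.
  rewrite big_nat_recr//=.
  suff : (Num.sqrt (r N))^-1 * a N <=
      2 * (Num.sqrt (r N) - Num.sqrt (r N.+1)) by lra.
  rewrite mulrC ler_pdivrMr//.
  have -> : a N = Num.sqrt (r N) ^+ 2 - Num.sqrt (r N.+1) ^+ 2.
    by rewrite !sqr_sqrtr// rS opprB addrC subrK.
  have : Num.sqrt (r N.+1) <= Num.sqrt (r N) by rewrite ler_wsqrtr// r_le.
  move: (sr_gt0 N) (sr_gt0 N.+1) => h1 h2 h3; nra.
Qed.

(** By Legendre's formula the valuation is a sum of quotients of [n] by powers of 2. Keeping the
    last quotient beside the partial sum closes the induction, since two rounded halves fit into
    it. *)
Lemma logn2_fact_le n : (logn 2 n`! <= n)%N.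
Proof.
rewrite logn_fact//.
suff h m : (\sum_(1 <= k < m.+1) n %/ 2 ^ k + n %/ 2 ^ m <= n)%N.
  exact: leq_trans (leq_addr _ _) (h n).
elim: m => [|m IH]; first by rewrite big_geq// divn1.
rewrite big_nat_recr//= -addnA addnn -muln2 expnSr divnMA.
by apply: leq_trans IH; rewrite leq_add2l leq_trunc_div.
Qed.

(* The set [N v] consists of the points [b j] where [j.+1] has 2-adic valuation
   [v]; consecutive points are spaced according to both valuations, which average
   to a finite gap. *)
Lemma separated_sets : exists N : nat -> set nat,
  [/\ forall v, exists C, exists2 f : nat -> nat, injective f &
        forall h, N v (f h) /\ (f h <= C.+1 * h.+1)%N,
      forall v n, N v n -> (v <= n)%N,
      forall v u n, N v n -> N u n -> v = u &
      forall v u n m, N v n -> N u m -> (n < m)%N -> (n + v + u <= m)%N].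
Proof.
pose k j := logn 2 j.+1.
(* Chosen so that [b j.+1 - b j = k j + k j.+1 + 1]. *)
pose b j := ((\sum_(i < j) k i).*2 + k j + j)%N.
have bS i j : (i < j)%N -> (b i + k i + k j < b j)%N.
  elim: j => // j IH; rewrite ltnS leq_eqVlt => /predU1P[->|/IH];
    rewrite /b big_ord_recr/= -!addnn; lia.
have b_inj i j : b i = b j -> i = j.
  by case: (ltngtP i j) => // /bS; lia.
exists (fun v => [set b j | j in [set j | k j = v]]); split.
(* [(g h).+1] runs over the odd multiples of [2 ^ v], the integers of valuation [v]; [6 * 2 ^ v]
   comes from [b (g h) <= 3 * (g h).+1]. *)
- move=> v; pose g h := (2 ^ v * h.*2.+1).-1.
  have gS h : (g h).+1 = (2 ^ v * h.*2.+1)%N.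
    by rewrite prednK// muln_gt0 expn_gt0.
  exists (6 * 2 ^ v).-1, (b \o g).
    move=> h h' /b_inj /(congr1 succn); rewrite !gS => /eqP.
    by rewrite eqn_pmul2l ?expn_gt0// => /eqP [] /double_inj.
  move=> h /=; split.
    exists (g h) => //=; rewrite /k gS lognM ?expn_gt0// pfactorK//.
    by rewrite logn_coprime ?addn0// prime_coprime// dvdn2 /= odd_double.
  rewrite prednK ?muln_gt0 ?expn_gt0//.
  have bg : (b (g h) <= 3 * (g h).+1)%N.
    have : (\sum_(i < (g h).+1) k i <= (g h).+1)%N.
      apply: leq_trans (logn2_fact_le _).
      elim: (g h).+1 => [|m IH]; first by rewrite big_ord0.
      by rewrite big_ord_recr/= factS lognM ?fact_gt0// addnC leq_add2l.
    rewrite /b big_ord_recr/=.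
    lia.
  apply: leq_trans bg _; rewrite gS; nia.
- by move=> v _ [j <- <-]; rewrite /b; lia.
- by move=> v u n [j <- <-] [i <-] /b_inj ->.
- move=> v u n m [i <- <-] [j <- <-] bij; apply: ltnW; apply: (bS).
  by case: (ltngtP i j) bij => [//|/bS|->]; lia.
Qed.

Lemma leq_count_upto (A : set nat) (f : nat -> nat) C n : injective f ->
  (forall h, A (f h) /\ (f h <= C.+1 * h.+1)%N) -> (n %/ C.+1 <= count_upto A n)%N.
Proof.
move=> fI fA; pose q := (n %/ C.+1)%N.
have fn (h : 'I_q) : (f h < n.+1)%N.
  rewrite ltnS (leq_trans (fA h).2)// (leq_trans _ (leq_trunc_div n C.+1))//.
  by rewrite mulnC leq_mul2r ltn_ord orbT.
pose g (h : 'I_q) : 'I_n.+1 := Ordinal (fn h).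
have gI : injective g by move=> h h' /(congr1 val) /= /fI /val_inj.
rewrite -[leqLHS](card_ord q) -(card_imset _ gI) /count_upto.
apply: subset_leq_card; apply/fintype.subsetP => _ /imsetP[h _ ->].
by rewrite inE; exact: (fA h).1.
Qed.

Lemma lower_density_gt0_of_injection (R : realType) (A : set nat)
    (f : nat -> nat) C :
  injective f -> (forall h, A (f h) /\ (f h <= C.+1 * h.+1)%N) ->
  (0 < lower_density R A)%E.
Proof.
move=> fI fA; have C0 : (0 : R) < (2 * C.+1)%:R by rewrite ltr0n.
(* The factor 2 absorbs rounding: from [C.+1] on, [n %/ C.+1] is at least 1, hence at least half of
   the exact quotient. *)
apply: (@lower_density_gt0 R A (2 * C.+1)%:R^-1 C.+1); first by rewrite invr_gt0.
move=> n Cn; rewrite mulrC ler_pdivrMr// -natrM ler_nat.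
have /leq_mul : (n %/ C.+1 <= count_upto A n)%N by exact: leq_count_upto fI fA.
move=> /(_ _ _ (leqnn (2 * C.+1))); apply: leq_trans.
have q0 : (0 < n %/ C.+1)%N by rewrite divn_gt0.
have := ltn_ceil n (ltn0Sn C); nia.
Qed.

Lemma sumr_split_le (R : realType) (f : nat -> R) Q N : (forall k, 0 <= f k) ->
  \sum_(0 <= k < N) f k <= \sum_(0 <= k < Q) f k + \sum_(Q <= k < N) f k.
Proof.
move=> f0; have [QN|NQ] := leqP Q N; first by rewrite (@big_cat_nat _ _ _ Q).
rewrite [X in _ + X]big_geq ?(ltnW NQ)// addr0.
by rewrite [leRHS](@big_cat_nat _ _ _ N) ?(ltnW NQ)//= lerDl sumr_ge0.
Qed.

(** * Countable dense sets of scalars and of finitely supported vectors *)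

Definition separable_scalars (R : realType) (K : scalars R) :=
  exists d : nat -> K, forall (x : K) (e : R), 0 < e ->
    exists n, modulus (x - d n) <= e.

Lemma separable_real_scalars (R : realType) : separable_scalars R (real_scalars R).
Proof.
exists (fun n => if unpickle n is Some q then ratr (q : rat) else 0).
move=> /= x e e0.
have [q] := @rat_in_itvoo R (x - e) (x + e) ltac:(lra).
rewrite in_itv/= => /andP[q1 q2]; exists (pickle q); rewrite pickleK.
by rewrite ler_norml; apply/andP; split; lra.
Qed.

Lemma separable_complex_scalars (R : realType) :
  separable_scalars R (complex_scalars R).
Proof.
exists (fun n => if unpickle n is Some q then
  Complex (ratr (q : rat * rat).1) (ratr q.2) else 0).
move=> /= -[a b] e e0.
have [q] := @rat_in_itvoo R (a - e / 2) (a + e / 2) ltac:(lra).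
have [r] := @rat_in_itvoo R (b - e / 2) (b + e / 2) ltac:(lra).
rewrite !in_itv/= => /andP[r1 r2] /andP[q1 q2].
exists (pickle (q, r)); rewrite pickleK /=.
rewrite -[leRHS]ger0_norm ?(ltW e0)// -sqrtr_sqr ler_wsqrtr//.
have h1 : (a - ratr q) ^+ 2 <= (e / 2) ^+ 2.
  rewrite -real_normK ?num_real// lerXn2r ?nnegrE ?normr_ge0 ?ler_norml//; first lra.
  by apply/andP; split; lra.
have h2 : (b - ratr r) ^+ 2 <= (e / 2) ^+ 2.
  rewrite -real_normK ?num_real// lerXn2r ?nnegrE ?normr_ge0 ?ler_norml//; first lra.
  by apply/andP; split; lra.
by move: h1 h2; rewrite expr_div_n; nra.
Qed.

Section dense_vectors.
Variables (R : realType) (K : scalars R) (p : R) (p1 : 1 <= p) (d : nat -> K).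
Hypothesis d_dense :
  forall (x : K) (e : R), 0 < e -> exists n, modulus (x - d n) <= e.

(** The entries of [s] are indices into [d], so these vectors are indexed by the countable type
    [seq nat]. *)
Definition finite_vector (s : seq nat) : nat -> K^o :=
  fun i => if (i < size s)%N then d (nth 0%N s i) else 0.

Lemma finite_support_lp (u : nat -> K^o) Q :
  (forall k, (Q <= k)%N -> u k = 0) -> u \in lp_pred p1.
Proof.
have p0 : 0 < p by exact: lt_le_trans p1.
move=> u0; apply: (@lp_predP_partial_sums R K p p1 u
  (\sum_(0 <= k < Q) modulus (u k) `^ p)).
move=> N; apply: le_trans (sumr_split_le _ _ Q _ (fun=> powR_ge0 _ _)) _.
rewrite gerDl big_nat big1// => k /andP[Qk _].
by rewrite u0// modulus0 powR0// gt_eqF.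
Qed.

Lemma finite_vector_lp s : finite_vector s \in lp_pred p1.
Proof.
by apply: (@finite_support_lp _ (size s)) => k sk; rewrite /finite_vector ltnNge sk.
Qed.

Lemma finite_vectors_dense (u : lp K p1) (e : R) : 0 < e ->
  exists s, `|u - Lp (finite_vector_lp s)| <= embed K e.
Proof.
move=> e0; have p0 : 0 < p by exact: lt_le_trans p1.
have ep0 : 0 < e `^ p by exact: powR_gt0.
have [M uM] := lp_partial_sums_bounded R K p p1 u.
have [Q uQ] := tail_small R _ M (e `^ p / 2) (fun k => powR_ge0 _ _) uM ltac:(lra).
(* Half of [e ^ p] is kept for the tail; the other half is shared among the first [Q] coordinates,
   [Q.+1] being a nonzero divisor. *)
pose h := e `^ p / 2 / Q.+1%:R.
have h0 : 0 < h by rewrite !divr_gt0.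
have /choice[g gP] := fun k => d_dense (u k) _ (powR_gt0 p^-1 h0).
exists (mkseq g Q); rewrite -(powRr1 (ltW e0)) -(mulfV (lt0r_neq0 p0)) powRrM.
apply: lp_norm_le => [|N]; first exact: powR_ge0.
apply: le_trans (sumr_split_le _ _ Q _ (fun=> powR_ge0 _ _)) _.
have uE k : (u - Lp (finite_vector_lp (mkseq g Q))) k =
   u k - finite_vector (mkseq g Q) k by [].
rewrite [leRHS](splitr (e `^ p)); apply: lerD; last first.
  apply: le_trans (uQ N); rewrite !big_nat; apply: ler_sum => k /andP[Qk _].
  by rewrite uE /finite_vector size_mkseq ltnNge Qk subr0.
apply: (@le_trans _ _ (\sum_(0 <= k < Q) h)).
  rewrite !big_nat; apply: ler_sum => k /andP[_ kQ].
  rewrite uE /finite_vector size_mkseq kQ nth_mkseq//.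
  have := gP k; rewrite -(@ler_powR2 R p) ?modulus_ge0 ?powR_ge0//.
  by rewrite -powRrM mulVf ?gt_eqF// powRr1// ltW.
rewrite sumr_const_nat subn0 -[leLHS]mulr_natr /h mulrAC ler_pdivrMr ?ltr0n//.
by rewrite ler_wpM2l ?ler_nat// divr_ge0// ltW.
Qed.

Variables (w : nat -> R) (w0 : forall n, 0 < w n).
Local Notation W := (weight R w).

(* The codes of the sequences [l :: s], with [l] arbitrary, give each finite
   vector infinitely many indices. *)
Lemma slow_dense_sequence (c : nat -> R) : (forall q, 0 <= c q) ->
  (forall C, exists Q, forall q, (Q <= q)%N -> C <= c q) ->
  exists y : nat -> nat -> K^o,
  [/\ forall v i, (v <= i)%N -> y v i = 0,
      forall v i q, (v <= q)%N -> (modulus (y v i) * W i) `^ p <= c q &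
      forall s V, exists2 v, (V <= v)%N & y v = finite_vector s].
Proof.
move=> c0 c_oo; have p0 : 0 < p by exact: lt_le_trans p1.
have W0 i : 0 <= W i by rewrite ltW// weight_gt0.
pose good s v := (size s <= v)%N /\
  forall i q, (v <= q)%N -> (modulus (finite_vector s i) * W i) `^ p <= c q.
pose Y v := behead (CodeSeq.decode v).
(* The zero vector is [good] at every index and replaces any vector coded too early. *)
exists (fun v => finite_vector (if `[< good (Y v) v >] then Y v else [::])).
have good_nil v : good [::] v.
  by split=> // i q _; rewrite /finite_vector /= modulus0 mul0r powR0 ?gt_eqF.
have good_if v : good (if `[< good (Y v) v >] then Y v else [::]) v.
  by case: asboolP => // _; exact: good_nil.
split.
- move=> v i vi; rewrite {1}/finite_vector ltnNge.
  by rewrite (leq_trans (good_if v).1).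
- by move=> v i q vq; exact: (good_if v).2.
move=> s V.
have [Q cQ] := c_oo
  (\sum_(0 <= i < size s) (modulus (finite_vector s i) * W i) `^ p).
(* A code exceeds each entry of its sequence, so the label [l] pushes [v] beyond all three
   thresholds. *)
pose l := (maxn V (maxn (size s) Q)).
have [v lv YE] : exists2 v, (l < v)%N & Y v = s.
  exists (CodeSeq.code (l :: s)); last by rewrite /Y CodeSeq.codeK.
  by case/andP: (CodeSeq.ltn_code (l :: s)).
have [Vl sl Ql] : [/\ V <= l, size s <= l & Q <= l]%N.
  by rewrite /l !leq_max !leqnn !orbT.
exists v; first exact: leq_trans Vl (ltnW lv).
rewrite YE asboolT//; split; first exact: leq_trans sl (ltnW lv).
move=> i q vq; apply: le_trans (cQ q _); last first.
  exact: leq_trans Ql (leq_trans (ltnW lv) vq).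
have [si|si] := leqP (size s) i.
  rewrite {1}/finite_vector ltnNge si/= modulus0 mul0r powR0 ?gt_eqF//.
  by apply: sumr_ge0 => j _; exact: powR_ge0.
rewrite (bigD1_seq i) ?mem_index_iota ?iota_uniq//= lerDl.
by apply: sumr_ge0 => j _; exact: powR_ge0.
Qed.

End dense_vectors.

(** * Construction of a frequently hypercyclic vector *)

Section construction.
Variables (R : realType) (K : scalars R) (p : R) (p1 : 1 <= p).
Variables (w : nat -> R) (w0 : forall n, 0 < w n).
Variable wb : bounded_fun (w : nat -> R^o).
Local Notation W := (weight R w).

(* [x] carries, on the block starting at each [m] in [N v], the vector [y v]
   pulled back by [B^m]; only blocks starting after time [n] contribute to the
   error, and they only meet coordinates [q >= v]. *)
Lemma shadowing_vector (c : nat -> R) (N : nat -> set nat) (y : nat -> nat -> K^o) :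
  (forall q, 0 <= c q) ->
  (forall v n, N v n -> (v <= n)%N) ->
  (forall v u n, N v n -> N u n -> v = u) ->
  (forall v u n m, N v n -> N u m -> (n < m)%N -> (n + v + u <= m)%N) ->
  (forall v i, (v <= i)%N -> y v i = 0) ->
  (forall v i q, (v <= q)%N -> (modulus (y v i) * W i) `^ p <= c q) ->
  exists x : nat -> K^o,
    (forall q, modulus (x q) `^ p <= c q * (W q `^ p)^-1) /\
    forall v n, N v n -> forall q,
      modulus (embed K (W (n + q) / W q) * x (n + q)%N - y v q : K) `^ p <=
      if (v <= q)%N then c q * (W q `^ p)^-1 else 0.
Proof.
move=> c0 N_ge N_inj N_sep y0 yc; have p0 : 0 < p by exact: lt_le_trans p1.
have W0 i : 0 < W i by exact: weight_gt0.
have W_neq0 i : W i != 0 by rewrite gt_eqF.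
pose blk q := [set vm : nat * nat | N vm.1 vm.2 /\ (vm.2 <= q < vm.2 + vm.1)%N].
have blk_inj q v m v' m' : blk q (v, m) -> blk q (v', m') -> (v, m) = (v', m').
  move=> [/= Nv /andP[mq qm]] [/= Nv' /andP[mq' qm']].
  have mm' : m = m'.
    case: (ltngtP m m') => // mm.
      by have := N_sep _ _ _ _ Nv Nv' mm; lia.
    by have := N_sep _ _ _ _ Nv' Nv mm; lia.
  by subst m'; rewrite (N_inj _ _ _ Nv Nv').
(* Outside all blocks the default [(0, 0)] selects [y 0 q], which is 0. *)
pose x q : K^o := let vm := xget (0, 0)%N (blk q) in
  embed K (W (q - vm.2)%N / W q) * y vm.1 (q - vm.2)%N.
have x_blk v m i : N v m -> (i < v)%N ->
    x (m + i)%N = embed K (W i / W (m + i)%N) * y v i.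
  move=> Nvm iv; have bq : blk (m + i)%N (v, m) by split=> //=; lia.
  rewrite /x; case: xgetP => [[v' m'] _ bq'|/(_ (v, m))//].
  by have [-> ->] := blk_inj _ _ _ _ _ bq' bq; rewrite /= addKn.
have x_case q : x q = 0 \/ exists v m i, [/\ N v m, (i < v)%N, q = (m + i)%N &
    x q = embed K (W i / W q) * y v i].
  rewrite {1}/x; case: xgetP => [[v m] _ [/= Nvm /andP[mq qm]]|_]; last first.
    by left; rewrite /= y0 ?mulr0.
  right; exists v, m, (q - m)%N.
  have qE : q = (m + (q - m))%N by lia.
  have iv : (q - m < v)%N by lia.
  by split=> //; have := x_blk v m _ Nvm iv; rewrite -qE.
have err v i q : (v <= q)%N ->
    modulus (embed K (W i / W q) * y v i : K) `^ p <= c q * (W q `^ p)^-1.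
  move=> vq; rewrite modulusM modulus_embed ger0_norm ?divr_ge0 ?(ltW (W0 _))//.
  rewrite ler_pdivlMr ?powR_gt0//.
  rewrite -powRM ?mulr_ge0 ?invr_ge0 ?modulus_ge0 ?(ltW (W0 _))//.
  by rewrite mulrAC divfK// mulrC yc.
have cW0 q : 0 <= c q * (W q `^ p)^-1 by rewrite mulr_ge0 ?invr_ge0 ?powR_ge0.
exists x; split=> [q|v n Nvn q].
  have [->|[v [m [i [Nvm iv qE ->]]]]] := x_case q.
    by rewrite modulus0 powR0 ?gt_eqF.
  by apply: err; rewrite qE (leq_trans (N_ge _ _ Nvm))// leq_addr.
case: leqP => [vq|qv]; last first.
  rewrite (x_blk v)// mulrA -rmorphM [X in embed K X]mulrC mulrA divfK//.
  by rewrite divff// rmorph1 mul1r subrr modulus0 powR0 ?gt_eqF.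
rewrite y0// subr0; have [->|[u [m [i [Num iu nqE ->]]]]] := x_case (n + q)%N.
  by rewrite mulr0 modulus0 powR0 ?gt_eqF.
(* A block starting before [n] would end by [n], and one starting at [n] would be that of [v], too
   short to reach [n + q]. Separation then yields [u <= q]. *)
have nm : (n < m)%N.
  case: (ltngtP n m) => // nm.
    by have := N_sep _ _ _ _ Num Nvn nm; lia.
  by subst m; have := N_inj _ _ _ Num Nvn; lia.
rewrite mulrA -rmorphM [X in embed K X]mulrC mulrA divfK//.
by apply: err; have := N_sep _ _ _ _ Nvn Num nm; lia.
Qed.

Lemma frequently_hypercyclic_of_bounded_sum (M : R) :
  separable_scalars R K ->
  (forall N, \sum_(0 <= n < N) (W n `^ p)^-1 <= M) ->
  frequently_hypercyclic R (weighted_shift K p1 wb).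
Proof.
move=> [d dd] aM; have p0 : 0 < p by exact: lt_le_trans p1.
have a0 q : 0 < (W q `^ p)^-1 by rewrite invr_gt0 powR_gt0// weight_gt0.
have [c [c0 c_oo [M' cM']]] := summable_slow_weights R _ M a0 aM.
have [y [y0 yc y_dense]] := slow_dense_sequence R K p p1 d w w0 c c0 c_oo.
have [N [N_dens N_ge N_inj N_sep]] := separated_sets.
have [x [xq xN]] := shadowing_vector c N y c0 N_ge N_inj N_sep y0 yc.
have xlp : x \in lp_pred p1.
  apply: (@lp_predP_partial_sums R K p p1 x M') => n.
  by apply: le_trans (cM' n); apply: ler_sum => q _.
have ca0 q : 0 <= c q * (W q `^ p)^-1 by rewrite mulr_ge0// ltW.
exists (Lp xlp) => U oU [u Uu].
have /nbhs_ballP[e /= e0 eU] : nbhs u U by exact: open_nbhs_nbhs.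
(* Both [u] and the orbit point will be within [r] of one finite vector, and [2 r] is less than the
   radius. *)
pose r := modulus e / 3.
have eE : e = embed K (modulus e) by rewrite embed_modulus ger0_norm// ltW.
have r0 : 0 < r.
  rewrite divr_gt0// lt_neqAle modulus_ge0 andbT eq_sym.
  by apply/eqP => /modulus0_eq0 e00; rewrite e00 ltxx in e0.
have [s us] := finite_vectors_dense R K p p1 d dd u r r0.
(* The error lives on coordinates [q >= v]; taking [v >= V] confines it to a tail of sum at most
   [r ^ p]. *)
have [V cV] := tail_small R _ M' (r `^ p) ca0 cM' (powR_gt0 _ r0).
have [v Vv yv] := y_dense s V.
have [C [f f_inj fN]] := N_dens v.
apply: (lower_density_gt0_of_injection R _ f C f_inj) => h.
split; last exact: (fN h).2.
set n := f h; apply: eU; rewrite -ball_normE /=.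
set z := iter _ _ _.
have zs : `|z - Lp (finite_vector_lp R K p p1 d s)| <= embed K r.
  rewrite -(powRr1 (ltW r0)) -(mulfV (lt0r_neq0 p0)) powRrM.
  apply: lp_norm_le => [|m]; first exact: powR_ge0.
  apply: le_trans (cV m).
  apply: (@le_trans _ _
    (\sum_(0 <= q < m) if (V <= q)%N then c q * (W q `^ p)^-1 else 0)).
    apply: ler_sum => q _.
    have := xN v n (fN h).1 q; rewrite yv => /le_trans.
    rewrite -[X in modulus (X - _)]
      (iter_weighted_shift R K p p1 w w0 wb n (Lp xlp) q).
    apply; case: leqP => vq; first by rewrite (leq_trans Vv).
    by case: ifP.
  apply: le_trans (sumr_split_le _ _ V _ _) _; first by move=> q; case: ifP.
  rewrite -[leRHS]add0r; apply: lerD.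
    by rewrite big_nat big1// => q /andP[_ qV]; rewrite leqNgt qV.
  by rewrite !big_nat; apply: ler_sum => q /andP[-> _].
have -> : u - z = (u - Lp (finite_vector_lp R K p p1 d s)) -
    (z - Lp (finite_vector_lp R K p p1 d s)) by rewrite opprB addrA subrK.
apply: le_lt_trans (ler_normB _ _) _.
apply: le_lt_trans (lerD us zs) _.
rewrite eE -rmorphD lt_neqAle ler_embed (inj_eq (fmorph_inj _)) -lt_neqAle.
by move: r0; rewrite /r; lra.
Qed.

End construction.

Theorem theorem4 (R : realType) (K : scalars R)
    (HK : K = real_scalars R \/ K = complex_scalars R)
    (p : R) (p1 : 1 <= p)
    (w : nat -> R) (w0 : forall n, 0 < w n)
    (wb : bounded_fun (w : nat -> R^o)) :
  let B : bounded_operator (lp K p1) := weighted_shift K p1 wb in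
  (frequently_hypercyclic R B <-> U_frequently_hypercyclic R B) /\
  (U_frequently_hypercyclic R B <->
   cvgn (fun N => \sum_(1 <= n < N) ((\prod_(1 <= k < n.+1) w k) `^ p)^-1)).
Proof.
move=> B; set S := (X in cvgn X).
have a0 n : 0 <= (weight R w n `^ p)^-1 by rewrite invr_ge0 powR_ge0.
have FU : frequently_hypercyclic R B -> U_frequently_hypercyclic R B.
  move=> [x xF]; exists x => U oU U0; apply: lt_le_trans (xF U oU U0) _.
  exact: limn_einf_sup.
have UC : U_frequently_hypercyclic R B -> cvgn S.
  move=> /bounded_sum_of_U_frequently_hypercyclic => /(_ w0) [M SM].
  apply: nondecreasing_is_cvgn; last by exists M => _ [N _ <-]; exact: SM.
  apply/nondecreasing_seqP => N; rewrite /S.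
  case: N => [|N]; first by rewrite !big_geq.
  by rewrite [leRHS]big_nat_recr//= lerDl; exact: a0.
have CF : cvgn S -> frequently_hypercyclic R B.
  move=> /cvg_has_ub[M SM].
  (* The series starts at 1 but the vector also has a coordinate 0, whose term is added to the
     bound. *)
  apply: (frequently_hypercyclic_of_bounded_sum R K p p1 w w0 wb
    (\sum_(0 <= n < 1) (weight R w n `^ p)^-1 + M)).
    by case: HK => ->;
      [exact: separable_real_scalars|exact: separable_complex_scalars].
  move=> N; apply: le_trans (sumr_split_le _ _ 1 _ a0) _.
  rewrite lerD2l; apply: le_trans (ler_norm _) _.
  by apply: SM; exists N.
by split; split=> // h; [exact/CF/UC|exact/FU/CF].
Qed.
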